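(* Let $R$ be a commutative Noetherian ring with identity, $\mathfrak{a}$ an ideal of $R$ and $M$ a finitely generated $R$-module. Let $x_1,\ldots,x_n\in\mathfrak{a}^2$. Then the following are equivalent: (i) $x_1,\ldots,x_n$ is an $\mathfrak{a}$-weak sequence on $M$. (ii) $\mathfrak{a}\,H^i_{\mathfrak{a}}(M)=0$ for all $0\le i<n$, and $x_1,\ldots,x_n$ is an $\mathfrak{a}$-filter regular sequence on $M$.
   Context: $H^i_{\mathfrak{a}}(M)$ is the $i$-th local cohomology module of $M$ with support in $\mathfrak{a}$. A sequence $x_1,\ldots,x_r$ of elements of $R$ is an $\mathfrak{a}$-filter regular sequence on $M$ if $\langle x_1,\ldots,x_{i-1}\rangle M:_M x_i\subseteq\bigcup_{t\in\mathbb{N}}\left(\langle x_1,\ldots,x_{i-1}\rangle M:_M\mathfrak{a}^t\right)$ for all $i=1,\ldots,r$. It is an $\mathfrak{a}$-weak sequence on $M$ if $\langle x_1,\ldots,x_{i-1}\rangle M:_M x_i\subseteq\langle x_1,\ldots,x_{i-1}\rangle M:_M\mathfrak{a}$ for all $i=1,\ldots,r$. *)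

(* Defs.v *)
From HB Require Import structures.
From mathcomp Require Import all_boot all_order all_algebra.
From mathcomp Require Import boolp classical_sets functions.

Set Implicit Arguments.
Unset Strict Implicit.
Unset Printing Implicit Defensive.

Import Order.TTheory GRing.Theory Num.Theory.

Local Open Scope ring_scope.

(* Submodules of an R-module V are MathComp's bundled predicates               *)
(* [submodClosed V]; the ideals of R are the submodules of the regular module  *)
(* R^o.  Rings are [comPzRingType], so that the zero ring is allowed, and      *)
(* predicates become boolean through the classical reflection `[< P >].        *)

Section Submodules.
Variables (R : comPzRingType) (V : lmodType R).

Definition submod_span (S : {pred V}) : {pred V} :=
  fun v => `[< forall N : submodClosed V, {subset S <= N} -> v \in N >].

Lemma submod_span_closed S : submod_closed (submod_span S).
Proof.
split; first by apply/asboolP => N _; exact: rpred0.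
move=> r x y /asboolP xS /asboolP yS; apply/asboolP => N SN.
by rewrite rpredD ?rpredZ ?xS ?yS.
Qed.

HB.instance Definition _ S :=
  GRing.isSubmodClosed.Build R V (submod_span S) (submod_span_closed S).

Lemma mem_submod_span (S : {pred V}) : {subset S <= submod_span S}.
Proof. by move=> x xS; apply/asboolP => N; apply. Qed.

Lemma submod_span_min (S : {pred V}) (N : submodClosed V) :
  {subset S <= N} -> {subset submod_span S <= N}.
Proof. by move=> SN x /asboolP; apply. Qed.

Definition finitely_generated :=
  exists s : seq V, forall v, v \in submod_span [in s].

(* I N, the submodule generated by the products r *: v *)
Definition ideal_mul (I : {pred R^o}) (N : {pred V}) : {pred V} :=
  submod_span (fun w => `[< exists r v, [/\ r \in I, v \in N & w = r *: v] >]).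

HB.instance Definition _ I N := GRing.SubmodClosed.on (ideal_mul I N).

(* N :_V J *)
Definition colon (N : {pred V}) (J : {pred R^o}) : {pred V} :=
  fun v => `[< forall r, r \in J -> r *: v \in N >].

End Submodules.

Arguments finitely_generated {R} V.

Definition noetherian (R : comPzRingType) :=
  forall I : submodClosed R^o, exists s : seq R^o, I =i submod_span [in s].

Fixpoint ideal_exp (R : comPzRingType) (I : {pred R^o}) (t : nat)
    : {pred R^o} :=
  if t is t'.+1 then ideal_mul I (ideal_exp I t') else predT.

Section Sequences.
Variables (R : comPzRingType) (M : lmodType R) (a : submodClosed R^o).

(* <x_0, ..., x_(i-1)> M *)
Definition prefix_mul (x : seq R) (i : nat) : {pred M} :=
  ideal_mul (submod_span [in take i x : seq R^o]) predT.

Definition filter_regular (x : seq R) :=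
  forall i, (i < size x)%N ->
  forall m, m \in colon (prefix_mul x i) (pred1 x`_i) ->
  exists t, m \in colon (prefix_mul x i) (ideal_exp a t).

Definition weak_sequence (x : seq R) :=
  forall i, (i < size x)%N ->
  {subset colon (prefix_mul x i) (pred1 x`_i) <= colon (prefix_mul x i) a}.

End Sequences.

Arguments filter_regular {R} M a x.
Arguments weak_sequence {R} M a x.

Section SubmodType.
Variables (R : comPzRingType) (V : lmodType R) (N : submodClosed V).

Record submod := Submod {submod_val :> V; submodP : submod_val \in N}.

HB.instance Definition _ := [isSub for submod_val].
HB.instance Definition _ := [Choice of submod by <:].
HB.instance Definition _ := [SubChoice_isSubLmodule of submod by <:].

End SubmodType.

Section QuotientModule.
Variables (R : comPzRingType) (V : lmodType R) (N : submodClosed V).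
Local Open Scope quotient_scope.

(* submodClosed does not inherit from the zmodClosed expected by Quotient *)
Definition submod_zmod : {pred V} := N.
Fact submod_zmod_closed : zmod_closed submod_zmod.
Proof. exact: submodClosedP. Qed.

HB.instance Definition _ :=
  GRing.isZmodClosed.Build V submod_zmod submod_zmod_closed.

Definition quot_mod := Quotient.quot submod_zmod.
HB.instance Definition _ := GRing.Zmodule.on quot_mod.
HB.instance Definition _ := EqQuotient.on quot_mod.

Definition quot_proj (v : V) : quot_mod := \pi v.

Definition quot_scale (r : R) (q : quot_mod) : quot_mod := quot_proj (r *: repr q).

Lemma quot_proj_eq (u v : V) : (quot_proj u = quot_proj v) <-> (u - v \in N).
Proof.
rewrite -[u - v \in N]/(u - v \in submod_zmod) Quotient.idealrBE.
by split => [/eqP|/eqP].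
Qed.

Lemma quot_projD u v : quot_proj (u + v) = quot_proj u + quot_proj v.
Proof. exact: (raddfD (\pi_(Quotient.quot submod_zmod))). Qed.

Lemma quot_projK (q : quot_mod) : quot_proj (repr q) = q.
Proof. exact: reprK. Qed.

Lemma quot_scaleE r v : quot_scale r (quot_proj v) = quot_proj (r *: v).
Proof.
by apply/quot_proj_eq; rewrite -scalerBr rpredZ//; apply/quot_proj_eq/quot_projK.
Qed.

Fact quot_scaleA r s q : quot_scale r (quot_scale s q) = quot_scale (r * s) q.
Proof. by rewrite -(quot_projK q) !quot_scaleE scalerA. Qed.

Fact quot_scale1 : left_id 1 quot_scale.
Proof. by move=> q; rewrite -(quot_projK q) quot_scaleE scale1r. Qed.

Fact quot_scaleDr : right_distributive quot_scale +%R.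
Proof.
move=> r p q; rewrite -(quot_projK p) -(quot_projK q).
by rewrite -quot_projD !quot_scaleE scalerDr quot_projD.
Qed.

Fact quot_scaleDl q : {morph quot_scale^~ q : r s / r + s}.
Proof.
by move=> r s; rewrite -(quot_projK q) !quot_scaleE scalerDl quot_projD.
Qed.

HB.instance Definition _ := GRing.Zmodule_isLmodule.Build R quot_mod
  quot_scaleA quot_scale1 quot_scaleDr quot_scaleDl.

Fact quot_proj_is_linear : linear quot_proj.
Proof. by move=> r u v; rewrite quot_projD -quot_scaleE. Qed.

HB.instance Definition _ := GRing.isLinear.Build R V quot_mod *:%R quot_proj
  quot_proj_is_linear.

End QuotientModule.

Section Cohomology.
Variable R : comPzRingType.

Record cochain := Cochain {
  cochain_obj :> nat -> lmodType R;
  differential : forall i, {linear cochain_obj i -> cochain_obj i.+1};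
  differential_comp : forall i x, differential i.+1 (differential i x) = 0
}.

Variable C : cochain.

Definition cocycle i : {pred C i} := fun x => differential C i x == 0.

Lemma cocycle_submod_closed i : submod_closed (@cocycle i).
Proof.
split; first by apply/eqP; rewrite linear0.
by move=> r x y /eqP dx /eqP dy; apply/eqP; rewrite linearP dx dy scaler0 addr0.
Qed.

HB.instance Definition _ i := GRing.isSubmodClosed.Build R (C i) (@cocycle i)
  (cocycle_submod_closed i).

(* the incoming differential in degree 0 is zero *)
Definition coboundary i : {pred C i} :=
  match i return {pred C i} with
  | 0 => pred1 0
  | j.+1 => fun x => `[< exists y, x = differential C j y >]
  end.

Lemma coboundary_submod_closed i : submod_closed (@coboundary i).
Proof.
case: i => [|i].
  split; rewrite ?inE// => r x y.
  by rewrite !inE => /eqP-> /eqP->; rewrite scaler0 addr0.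
split; first by apply/asboolP; exists 0; rewrite linear0.
move=> r _ _ /asboolP[x ->] /asboolP[y ->]; apply/asboolP.
by exists (r *: x + y); rewrite linearP.
Qed.

HB.instance Definition _ i := GRing.isSubmodClosed.Build R (C i) (@coboundary i)
  (coboundary_submod_closed i).

Definition boundary_cocycle i : {pred submod (@cocycle i)} :=
  fun z => val z \in @coboundary i.

Lemma boundary_cocycle_submod_closed i : submod_closed (@boundary_cocycle i).
Proof.
split; first by rewrite unfold_in rpred0.
by move=> r x y xB yB; rewrite unfold_in rpredD ?rpredZ.
Qed.

HB.instance Definition _ i := GRing.isSubmodClosed.Build R _
  (@boundary_cocycle i) (boundary_cocycle_submod_closed i).

(* H^i(C) = ker (differential C i) / im (differential C (i - 1)) *)
Definition cohomology i : lmodType R := quot_mod (@boundary_cocycle i).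

End Cohomology.


Section Torsion.
Variables (R : comPzRingType) (a : submodClosed R^o).

Lemma ideal_exp_le s t : (s <= t)%N -> {subset ideal_exp a t <= ideal_exp a s}.
Proof.
move=> /subnK <-; elim: (t - s)%N => [|k IHk] x //.
rewrite addSn => xI; apply: IHk; move: xI.
case: (k + s)%N => [|j] //.
apply: submod_span_min => _ /asboolP[r [v [ra va ->]]]; exact: rpredZ.
Qed.

(* the union of the submodules 0 :_V a^t *)
Definition torsion_pred (V : lmodType R) : {pred V} :=
  fun v => `[< exists t, v \in colon (pred1 0) (ideal_exp a t) >].

Lemma torsion_submod_closed V : submod_closed (@torsion_pred V).
Proof.
split; first by apply/asboolP; exists 0; apply/asboolP => r _; rewrite !inE scaler0.
move=> c u v /asboolP[s /asboolP us] /asboolP[t /asboolP vt].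
apply/asboolP; exists (maxn s t); apply/asboolP => r rI.
have /us/eqP ru : r \in ideal_exp a s by apply: ideal_exp_le rI; rewrite leq_maxl.
have /vt/eqP rv : r \in ideal_exp a t by apply: ideal_exp_le rI; rewrite leq_maxr.
by rewrite !inE scalerDr scalerA mulrC -scalerA ru rv scaler0 addr0.
Qed.

HB.instance Definition _ V := GRing.isSubmodClosed.Build R V (@torsion_pred V)
  (@torsion_submod_closed V).

Definition torsion (V : lmodType R) : lmodType R := submod (@torsion_pred V).

Section TorsionMap.
Variables (V W : lmodType R) (f : {linear V -> W}).

Fact torsion_map_subproof (v : torsion V) : f (val v) \in @torsion_pred W.
Proof.
case: v => v /= /asboolP[t /asboolP vt]; apply/asboolP; exists t.
by apply/asboolP => r /vt /eqP rv; rewrite !inE -linearZ rv linear0.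
Qed.

Definition torsion_map (v : torsion V) : torsion W :=
  Submod (torsion_map_subproof v).

Fact torsion_map_is_linear : linear torsion_map.
Proof. by move=> r u v; apply: val_inj; rewrite /= !linearP. Qed.

HB.instance Definition _ := GRing.isLinear.Build R (torsion V) (torsion W)
  *:%R torsion_map torsion_map_is_linear.

End TorsionMap.

Program Definition torsion_cochain (C : cochain R) : cochain R :=
  @Cochain R (fun i => torsion (C i)) (fun i => torsion_map (differential C i)) _.
Next Obligation. by apply: val_inj; rewrite /= differential_comp. Qed.

End Torsion.

Section InjectiveResolutions.
Variable R : comPzRingType.

Definition injective_module (E : lmodType R) :=
  forall (A B : lmodType R) (j : {linear A -> B}) (f : {linear A -> E}),
    injective j -> exists g : {linear B -> E}, forall x, g (j x) = f x.

Record injective_resolution (M : lmodType R) := InjectiveResolution {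
  resolution :> cochain R;
  augmentation : {linear M -> resolution 0};
  resolution_injective : forall i, injective_module (resolution i);
  augmentation_inj : injective augmentation;
  augmentation_exact : forall x,
    differential resolution 0 x = 0 <-> exists m, x = augmentation m;
  resolution_exact : forall i x,
    differential resolution i.+1 x = 0 <-> exists y, x = differential resolution i y
}.

End InjectiveResolutions.

(* Existence of injective resolutions: divisible abelian groups are injective  *)
(* (graph_extend), hence so is every product of copies of Hom_Z(R, Q/Z), and   *)
(* each module embeds into such a product (coind_emb).                         *)

Section DivisibleExtension.
Variables (B D : zmodType).
Hypothesis divD : forall (n : nat) (d : D), (0 < n)%N -> exists e, e *+ n = d.

Let T := (B * D)%type.

Definition subgroup_graph (G : set T) :=
  [/\ G (0, 0), forall p q, G p -> G q -> G (p.1 - q.1, p.2 - q.2)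
    & forall d, G (0, d) -> d = 0].

Section Graph.
Variables (G : set T) (GG : subgroup_graph G).

Lemma graph0 : G (0, 0). Proof. by case: GG. Qed.

Lemma graphB x y x' y' : G (x, y) -> G (x', y') -> G (x - x', y - y').
Proof. by case: GG => _ GB _ /GB h /h. Qed.

Lemma graphN x y : G (x, y) -> G (- x, - y).
Proof. by move=> h; rewrite -[- x]sub0r -[- y]sub0r; apply: graphB => //; exact: graph0. Qed.

Lemma graphD x y x' y' : G (x, y) -> G (x', y') -> G (x + x', y + y').
Proof. by move=> h /graphN h'; rewrite -[x']opprK -[y']opprK; exact: graphB. Qed.

Lemma graph_fun x y y' : G (x, y) -> G (x, y') -> y = y'.
Proof.
case: GG => _ _ G0 h h'; apply/eqP; rewrite -subr_eq0; apply/eqP/G0.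
by rewrite -(subrr x); exact: graphB.
Qed.

Lemma graphMn x y n : G (x, y) -> G (x *+ n, y *+ n).
Proof.
move=> h; elim: n => [|n IHn]; first by rewrite !mulr0n; exact: graph0.
by rewrite !mulrS; exact: graphD.
Qed.

Lemma graphMz x y n : G (x, y) -> G (x *~ n, y *~ n).
Proof.
case: n => n h; first exact: graphMn.
by rewrite !NegzE !mulrNz; apply/graphN/graphMn.
Qed.

Definition graph_add (b : B) (d : D) : set T :=
  [set p | exists x y k, G (x, y) /\ p = (x + b *~ k, y + d *~ k)].

Lemma graph_add_sub b d : (G `<=` graph_add b d)%classic.
Proof. by move=> [x y] h; exists x, y, 0; rewrite !mulr0z !addr0. Qed.

Lemma graph_add_subgroup b : exists d, subgroup_graph (graph_add b d).
Proof.
suff [d dP] : exists d, forall k y, G (b *~ k, y) -> y = d *~ k.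
  exists d; split.
  - by apply: graph_add_sub; exact: graph0.
  - move=> _ _ [x [y [k [h ->]]]] [x' [y' [k' [h' ->]]]] /=.
    exists (x - x'), (y - y'), (k - k'); split; first exact: graphB.
    by rewrite !mulrzBr !opprD; congr (_, _); rewrite addrACA.
  - move=> e [x [y [k [h [/esym/eqP xk ->]]]]].
    move: xk; rewrite addrC addr_eq0 => /eqP bk.
    by rewrite -(dP k (- y)) ?subrr// bk; exact: graphN.
have [[n [n0 [y h]]]|none] :=
    pselect (exists n, (0 < n)%N /\ exists y, G (b *+ n, y)); last first.
  exists 0 => k y h; rewrite mul0rz.
  case: k h => [[|n]|n] h.
  - by apply: (graph_fun h); rewrite mulr0z; exact: graph0.
  - by exfalso; apply: none; exists n.+1; split=> //; exists y.
  - exfalso; apply: none; exists n.+1; split=> //; exists (- y).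
    by rewrite -[b *+ _]opprK; apply: graphN.
pose P n := `[< (0 < n)%N /\ exists y, G (b *+ n, y) >].
have exP : exists n, P n by exists n; apply/asboolP; split=> //; exists y.
case: (ex_minnP exP) => m /asboolP[m0 [e hm]] mmin {n n0 y h exP}.
have [d de] := divD e m0; exists d => k y h.
have k_eq := divz_eq k m.
set q := (k %/ m)%Z in k_eq; set r := (k %% m)%Z in k_eq.
have hq : G (b *~ (q * m), e *~ q).
  by rewrite [q * _]mulrC mulrzA; exact: graphMz.
have hr : G (b *~ r, y - e *~ q).
  have -> : r = k - q * m by rewrite k_eq addrAC subrr add0r.
  by rewrite mulrzBr; exact: graphB.
have r0 : r = 0.
  have : 0 <= r by rewrite modz_ge0// eqz_nat -lt0n.
  have : r < m%:Z by rewrite ltz_pmod.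
  case: (r) hr => // -[|j] // hr jm _.
  have /mmin : P j.+1 by apply/asboolP; split=> //; exists (y - e *~ q).
  by rewrite leqNgt; move: jm; rewrite ltz_nat => ->.
move: hr; rewrite r0 mulr0z => hr.
have /eqP := graph_fun hr graph0; rewrite subr_eq0 => /eqP ->.
by rewrite k_eq r0 addr0 -de [q * _]mulrC mulrzA.
Qed.

End Graph.

Lemma graph_extend (G0 : set T) : subgroup_graph G0 ->
  exists g : {additive B -> D}, forall x y, G0 (x, y) -> g x = y.
Proof.
move=> G0G.
pose P (G : set T) := (G !=set0)%classic -> subgroup_graph G /\ (G0 `<=` G)%classic.
have [|G [PG Gmax]] := @Zorn_bigcup _ P.
  move=> F FP Ftot [p [G FG Gp]].
  have ne H : F H -> H !=set0%classic -> subgroup_graph H /\ (G0 `<=` H)%classic.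
    by move=> /FP.
  have [[G00 GB GF] GG0] : subgroup_graph G /\ (G0 `<=` G)%classic.
    by apply: FP => //; exists p.
  split; last by move=> q /GG0 Gq; exists G.
  split; first by exists G.
    move=> u v [H FH Hu] [K FK Kv].
    have [HG _] := FP _ FH (ex_intro _ u Hu).
    have [KG _] := FP _ FK (ex_intro _ v Kv).
    case: (Ftot _ _ FH FK) => sub.
      by exists K => //; case: KG => _ KB _; apply: KB => //; apply: sub.
    by exists H => //; case: HG => _ HB _; apply: HB => //; apply: sub.
  move=> d [H FH Hd].
  by have [[_ _ HF] _] := FP _ FH (ex_intro _ _ Hd); exact: HF.
have GN0 : (G !=set0)%classic.
  apply/set0P/negP => /eqP GE; apply: (Gmax G0).
    rewrite GE; split; first exact: sub0set.
    by case: G0G => h _ _ /(_ _ h).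
  by move=> _; split.
have [GG G0sub] := PG GN0.
have total x : exists y, G (x, y).
  have [d dG] := graph_add_subgroup GG x.
  have xG : graph_add G x d (x, d).
    exists 0, 0, 1; rewrite !mulr1z !add0r; split=> //; exact: graph0.
  apply: contrapT => nG; apply: (Gmax (graph_add G x d)).
    by split; [exact: graph_add_sub|move=> sub; apply: nG; exists d; exact: sub].
  move=> _; split=> //; exact: subset_trans G0sub (@graph_add_sub _ _ _).
have [g gP] := choice total.
have gB : zmod_morphism g.
  move=> x y; apply: (graph_fun GG) (gP _) _; exact: graphB.
pose gM := GRing.isZmodMorphism.Build B D g gB.
pose ga : {additive B -> D} := HB.pack g gM.
exists ga => x y h; exact: (graph_fun GG) (gP x) (G0sub _ h).
Qed.

End DivisibleExtension.

Definition rat_int : {pred rat} := fun x => `[< exists k : int, x = k%:~R >].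

Fact rat_int_zmod_closed : zmod_closed rat_int.
Proof.
split; first by apply/asboolP; exists 0.
move=> _ _ /asboolP[k ->] /asboolP[l ->]; apply/asboolP.
by exists (k - l); rewrite rmorphB.
Qed.

HB.instance Definition _ :=
  GRing.isZmodClosed.Build rat rat_int rat_int_zmod_closed.

Definition QmodZ := Quotient.quot rat_int.
HB.instance Definition _ := GRing.Zmodule.on QmodZ.

Section QmodZTheory.
Local Open Scope quotient_scope.

Let pr (x : rat) : QmodZ := \pi_(Quotient.quot rat_int) x.

Let prB : {morph pr : x y / x - y}.
Proof. exact: (raddfB (\pi_(Quotient.quot rat_int))). Qed.

Let prMz x k : pr (x *~ k) = pr x *~ k.
Proof. exact: (raddfMz (\pi_(Quotient.quot rat_int)) k x). Qed.

Let pr_eq0 x : (pr x = 0) <-> x \in rat_int.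
Proof.
rewrite -(subr0 x) Quotient.idealrBE subr0.
have <- : pr 0 = 0 := raddf0 (\pi_(Quotient.quot rat_int)).
by split => [/eqP|/eqP].
Qed.

Lemma QmodZ_divisible (n : nat) (d : QmodZ) : (0 < n)%N -> exists e, e *+ n = d.
Proof.
move=> n0; exists (pr (repr d / n%:R)).
rewrite -[_ *+ n]/(_ *~ n%:Z) -prMz -mulrzr -[n%:Z%:~R]/(n%:R : rat).
by rewrite divfK ?pnatr_eq0 -?lt0n//; exact: reprK.
Qed.

Lemma QmodZ_separates (M : zmodType) (m : M) : m != 0 ->
  exists f : {additive M -> QmodZ}, f m != 0.
Proof.
move=> m0.
suff [x xm xN] : exists2 x : rat, (forall k : int, m *~ k = 0 -> x *~ k \in rat_int)
                                 & x \notin rat_int.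
  pose G : set (M * QmodZ) :=
    [set p | exists k : int, p = (m *~ k, pr x *~ k)]%classic.
  have [|f fP] := @graph_extend M QmodZ QmodZ_divisible G.
    split; first by exists 0; rewrite !mulr0z.
    - by move=> _ _ [k ->] [l ->]; exists (k - l); rewrite !mulrzBr.
    - move=> d [k [/esym mk ->]]; rewrite -prMz; exact/pr_eq0/xm.
  exists f; have -> : f m = pr x by apply: fP; exists 1; rewrite !mulr1z.
  by apply: contra xN => /eqP; rewrite pr_eq0.
have inv_notin (n : nat) : (1 < n)%N -> n%:R^-1 \notin rat_int.
  move=> n1; apply/negP => /asboolP[k nk].
  have n0 : (n%:R : rat) != 0 by rewrite pnatr_eq0; case: n n1 nk.
  have : (k * n%:Z)%:~R = 1 :> rat by rewrite rmorphM /= -nk mulVf.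
  move=> /eqP; rewrite -[1]/(1%:~R) eqr_int => /eqP kn.
  have : (n%:Z %| 1)%Z by apply/dvdzP; exists k; rewrite kn.
  by rewrite dvdz1 /=; case: n n1 {nk n0 kn} => [|[|]].
have [exP|none] := pselect (exists n, (0 < n)%N && (m *+ n == 0)); last first.
  exists (2%:R^-1); last exact: inv_notin.
  move=> k; case: (eqVneq k 0) => [-> _|k0 mk]; first by rewrite mulr0z rpred0.
  exfalso; apply: none; exists `|k|%N; rewrite absz_gt0 k0/=.
  by case: k mk {k0} => k; rewrite ?NegzE ?mulrNz ?abszN => /eqP; rewrite ?oppr_eq0.
case: (ex_minnP exP) => n /andP[n0 /eqP mn] nmin.
exists (n%:R^-1); last first.
  apply: inv_notin; case: n n0 mn {nmin} => [|[|n]] // _.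
  by rewrite mulr1n => /eqP; rewrite (negPf m0).
move=> k mk.
have k_eq := divz_eq k n.
set q := (k %/ n)%Z in k_eq; set r := (k %% n)%Z in k_eq.
have r0 : r = 0.
  have mr : m *~ r = 0.
    have -> : r = k - n%:Z * q by rewrite mulrC {1}k_eq addrAC subrr add0r.
    by rewrite mulrzBr mk mulrzA -[m *~ n]/(m *+ n) mn mul0rz subr0.
  have : 0 <= r by rewrite modz_ge0// eqz_nat -lt0n.
  have : r < n%:Z by rewrite ltz_pmod.
  case: (r) mr => // -[|j] // mj jn _.
  have /nmin : (0 < j.+1)%N && (m *+ j.+1 == 0) by apply/eqP.
  by rewrite leqNgt; move: jn; rewrite ltz_nat => ->.
apply/asboolP; exists q.
rewrite k_eq r0 addr0 mulrC mulrzA; congr (_ *~ _).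
by rewrite -[LHS]mulr_natr mulVf// pnatr_eq0 -lt0n.
Qed.

End QmodZTheory.

Section EnoughInjectives.
Variables (R : comPzRingType) (M : lmodType R).

Let T := {additive M -> QmodZ}.

(* functions T -> Hom_Z(R, Q/Z) *)
Definition coind_pred : {pred T -> R -> QmodZ} :=
  fun h => `[< forall t, zmod_morphism (h t) >].

Fact coind_zmod_closed : zmod_closed coind_pred.
Proof.
split; first by apply/asboolP => t x y; rewrite subr0.
move=> h h' /asboolP hB /asboolP hB'; apply/asboolP => t x y.
rewrite -[LHS]/(h t (x - y) - h' t (x - y)).
rewrite -[RHS]/((h t x - h' t x) - (h t y - h' t y)).
by rewrite hB hB' opprB addrACA [- _ + _]addrC !opprB addrACA.
Qed.

HB.instance Definition _ := GRing.isZmodClosed.Build _ coind_pred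
  coind_zmod_closed.

Record coind := Coind {coind_val :> T -> R -> QmodZ; coindP : coind_val \in coind_pred}.
HB.instance Definition _ := [isSub for coind_val].
HB.instance Definition _ := [Choice of coind by <:].
HB.instance Definition _ := [SubChoice_isSubZmodule of coind by <:].

Lemma coindB (h : coind) t : zmod_morphism (h t).
Proof. by move: (coindP h) => /asboolP. Qed.

Lemma coindD (h : coind) t x y : h t (x + y) = h t x + h t y.
Proof.
have h0 : h t 0 = 0 by rewrite -(subrr 0) coindB subrr.
by rewrite -{1}[y]opprK coindB -[- y]sub0r coindB h0 sub0r opprK.
Qed.

Fact coind_scale_subproof (r : R) (h : coind) :
  (fun t x => h t (x * r)) \in coind_pred.
Proof. by apply/asboolP => t x y; rewrite mulrBl coindB. Qed.

Definition coind_scale r h := Coind (coind_scale_subproof r h).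

Lemma coind_ext (h h' : coind) : (forall t x, h t x = h' t x) -> h = h'.
Proof. by move=> hh'; apply/val_inj/funext => t; apply/funext => x; exact: hh'. Qed.

Fact coind_scaleA r s h : coind_scale r (coind_scale s h) = coind_scale (r * s) h.
Proof. by apply: coind_ext => t x /=; rewrite mulrA. Qed.

Fact coind_scale1 : left_id 1 coind_scale.
Proof. by move=> h; apply: coind_ext => t x /=; rewrite mulr1. Qed.

Fact coind_scaleDr : right_distributive coind_scale +%R.
Proof. by move=> r h h'; apply: coind_ext. Qed.

Fact coind_scaleDl h : {morph coind_scale^~ h : r s / r + s}.
Proof. by move=> r s; apply: coind_ext => t x; rewrite /= mulrDr coindD. Qed.

HB.instance Definition _ := GRing.Zmodule_isLmodule.Build R coind
  coind_scaleA coind_scale1 coind_scaleDr coind_scaleDl.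

Lemma coind_injective : injective_module coind.
Proof.
move=> A B j f jI.
have ext t : exists g : {additive B -> QmodZ}, forall x, g (j x) = f x t 1.
  pose G : set (B * QmodZ) := [set p | exists x, p = (j x, f x t 1)]%classic.
  have [|g gP] := @graph_extend _ _ QmodZ_divisible G.
    split; first by exists 0; rewrite !linear0.
    - by move=> _ _ [x ->] [y ->]; exists (x - y); rewrite !linearB.
    - move=> d [x [/esym jx ->]].
      have -> : x = 0 by apply: jI; rewrite jx linear0.
      by rewrite linear0.
  by exists g => x; apply: gP; exists x.
have [g gP] := choice ext.
have gH b : (fun t x => g t (x *: b)) \in coind_pred.
  by apply/asboolP => t x y; rewrite scalerBl raddfB.
pose F b : coind := Coind (gH b).
have Flin : linear F.
  move=> r b b'; apply: coind_ext => t x.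
  by rewrite /= scalerDr raddfD scalerA.
pose Fl : {linear B -> coind} := HB.pack F (GRing.isLinear.Build R B coind *:%R F Flin).
exists Fl => x; apply: coind_ext => t s.
by rewrite /= -linearZ gP linearZ /= mul1r.
Qed.

Fact coind_emb_subproof m : (fun (t : T) (r : R) => t (r *: m)) \in coind_pred.
Proof. by apply/asboolP => t x y; rewrite scalerBl raddfB. Qed.

Definition coind_emb m : coind := Coind (coind_emb_subproof m).

Fact coind_emb_linear : linear coind_emb.
Proof.
by move=> r m n; apply: coind_ext => t x; rewrite /= scalerDr raddfD scalerA.
Qed.

HB.instance Definition _ := GRing.isLinear.Build R M coind *:%R coind_emb
  coind_emb_linear.

Lemma coind_emb_inj : injective coind_emb.
Proof.
move=> m n mn; apply/eqP; rewrite -subr_eq0; apply: contraT => /QmodZ_separates.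
move=> [t]; have := congr1 (fun h : coind => h t 1) mn.
by rewrite /= !scale1r raddfB => ->; rewrite subrr eqxx.
Qed.

End EnoughInjectives.

Section Existence.
Variables (R : comPzRingType) (M : lmodType R).

Definition lin_image (V W : lmodType R) (f : {linear V -> W}) : {pred W} :=
  fun w => `[< exists v, w = f v >].

Fact lin_image_submod_closed V W f : submod_closed (@lin_image V W f).
Proof.
split; first by apply/asboolP; exists 0; rewrite linear0.
move=> r _ _ /asboolP[x ->] /asboolP[y ->]; apply/asboolP.
by exists (r *: x + y); rewrite linearP.
Qed.

HB.instance Definition _ V W f := GRing.isSubmodClosed.Build R W (@lin_image V W f)
  (@lin_image_submod_closed V W f).

Fixpoint cosyzygy (i : nat) : lmodType R :=
  if i is j.+1 then quot_mod (@lin_image _ _ (@coind_emb R (cosyzygy j))) else M.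

Let E i : lmodType R := coind (cosyzygy i).
Let pr i : {linear E i -> cosyzygy i.+1} :=
  @quot_proj R (E i) (@lin_image _ _ (@coind_emb R (cosyzygy i))).
Let d i : {linear E i -> E i.+1} := @coind_emb R (cosyzygy i.+1) \o pr i.

Let d_eq0 i x : d i x = 0 <-> exists y, x = @coind_emb R (cosyzygy i) y.
Proof.
have -> : d i x = 0 <-> pr i x = pr i 0.
  rewrite (linear0 (pr i)) /=; split => [|->]; last exact: linear0.
  by rewrite -[0 in X in X -> _](linear0 (@coind_emb R (cosyzygy i.+1))) => /coind_emb_inj.
by rewrite quot_proj_eq subr0; split => /asboolP.
Qed.

Lemma injective_resolution_exists : inhabited (injective_resolution M).
Proof.
have dd i x : d i.+1 (d i x) = 0 by apply/d_eq0; exists (pr i x).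
constructor; apply: (@InjectiveResolution R M (Cochain dd)
  (@coind_emb R M : {linear M -> E 0})).
- by move=> i; exact: coind_injective.
- exact: coind_emb_inj.
- exact: d_eq0.
- move=> i x; rewrite d_eq0; split=> -[y ->]; last by exists (pr i y).
  by exists (repr y); congr (@coind_emb R _ _); rewrite /= quot_projK.
Qed.

End Existence.

Definition injective_resolution_of (R : comPzRingType) (M : lmodType R)
    : injective_resolution M :=
  inhabited_witness (injective_resolution_exists M).

(* H^i_a(M), the i-th right derived functor of [torsion a] at M *)
Definition local_cohomology (R : comPzRingType) (a : submodClosed R^o)
    (i : nat) (M : lmodType R) : lmodType R :=
  cohomology (torsion_cochain a (injective_resolution_of M)) i.

Definition annihilates (R : comPzRingType) (a : {pred R^o}) (V : lmodType R) :=
  forall r : R, r \in a -> forall v : V, r *: v = 0.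

(* Main.v *)
(* Local cohomology of M/xM is compared with that of M.  Let x be a-filter       *)
(* regular on M, with injective resolutions E of M and F of M/xM.  The cone of   *)
(* x : E -> E maps to F, and the cone of this map is an injective resolution of  *)
(* 0 :_M x, which is a-torsion, hence Gamma_a-acyclic; so H^i_a(M/xM) is the     *)
(* cohomology of the cone of x on Gamma_a(E).  Its cocycles are the pairs (y, w) *)
(* with dy = 0 and xy = dw.  If a annihilates H^i_a(M) and H^{i+1}_a(M) and      *)
(* x is in a^2, then a annihilates the classes of these pairs, i.e. H^i_a(M/xM). *)
(* Conversely, if a annihilates H^i_a(M/xM), it annihilates the kernel of x on   *)
(* H^{i+1}_a(M), and then, x being in a^2, all of this torsion module.  The      *)
(* theorem follows by induction on the length of the sequence.                   *)

From HB Require Import structures.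
Require Import Defs.
From mathcomp Require Import all_boot all_order all_algebra.
From mathcomp Require Import boolp classical_sets.

Set Implicit Arguments.
Unset Strict Implicit.
Unset Printing Implicit Defensive.

Import GRing.Theory.
Local Open Scope ring_scope.

(** Both kinds of sequence peel off their first element x: [weak_sequence_cons] and
    [filter_regular_cons] leave a condition on 0 :_M x and the same property on M/xM. The induction
    must therefore relate annihilation of H_a(M) to that of H_a(M/xM). The long exact sequence makes
    H^i_a(M/xM) an extension of the kernel of x on H^{i+1}_a(M) by the cokernel of x on H^i_a(M),
    which only shows that a^2 kills it. The lost factor is recovered from x in a^2 by a careful
    choice of primitives ([square_primitive], [cone_annihilates]). Conversely, a torsion module is
    killed by a once the kernel of x on it is ([annihilates_of_kernel]). Explicit primitives are
    available because H_a(M/xM) is computed by the cone of x on Gamma_a(E) ([cone_cohomology]). Over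
    a noetherian ring this rests on two facts: Gamma_a preserves injectives ([torsion_injective]),
    and an injective resolution of a torsion module stays exact in positive degrees under Gamma_a
    ([torsion_exact]). *)

Lemma dependent_choice_nat (S : nat -> Type) (P : forall i, S i -> Prop)
    (Q : forall i, S i -> S i.+1 -> Prop) (s0 : S 0) :
  P 0 s0 -> (forall i s, P i s -> exists s', P i.+1 s' /\ Q i s s') ->
  exists s : forall i, S i, s 0 = s0 /\ forall i, Q i (s i) (s i.+1).
Proof.
move=> Ps0 step.
have next i (u : {s : S i | P i s}) : {v : {s : S i.+1 | P i.+1 s} | Q i (sval u) (sval v)}.
  have [s' [Ps' Qs]] := cid (step i _ (svalP u)).
  by exists (exist _ s' Ps').
pose f := nat_rect (fun i => {s : S i | P i s}) (exist _ s0 Ps0)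
  (fun i u => sval (next i u)).
by exists (fun i => sval (f i)); split=> // i; exact: (svalP (next i (f i))).
Qed.

(** * Linear maps, injectivity and chains of ideals *)

Section Linear.
Variable R : comPzRingType.
Implicit Types U V W : lmodType R.

Definition mk_linear U V (f : U -> V) (f_lin : linear f) : {linear U -> V} :=
  HB.pack f (GRing.isLinear.Build R U V *:%R f f_lin).

Definition mk_submod V (N : {pred V}) (N_closed : submod_closed N) :
  submodClosed V := HB.pack N (GRing.isSubmodClosed.Build R V N N_closed).

Lemma submodB V (N : submodClosed V) u v : u \in N -> v \in N -> u - v \in N.
Proof. by move=> uN vN; rewrite -scaleN1r rpredD ?rpredZ. Qed.

Lemma submod_span_ind V (S : {pred V}) (P : V -> Prop) :
  P 0 -> (forall r u v, P u -> P v -> P (r *: u + v)) ->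
  (forall v, v \in S -> P v) -> forall v, v \in submod_span S -> P v.
Proof.
move=> P0 PD PS.
have Nc : submod_closed (fun v => `[< P v >] : bool).
  split; first exact/asboolP.
  by move=> r u v /asboolP Pu /asboolP Pv; apply/asboolP/PD.
move=> v /(@submod_span_min _ _ _ (mk_submod Nc)) vN; apply/asboolP/vN.
by move=> u /PS Pu; apply/asboolP.
Qed.

Definition kernel U V (f : {linear U -> V}) : {pred U} := fun u => f u == 0.

Fact kernel_closed U V (f : {linear U -> V}) : submod_closed (kernel f).
Proof.
split; first by rewrite unfold_in linear0.
move=> r u v; rewrite !unfold_in => /eqP fu /eqP fv.
by rewrite linearP fu fv scaler0 addr0.
Qed.

HB.instance Definition _ U V f := GRing.isSubmodClosed.Build R U (@kernel U V f)
  (@kernel_closed U V f).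

Lemma quot_factor U (N : submodClosed U) V (f : {linear U -> V}) :
  (forall u, u \in N -> f u = 0) ->
  exists g : {linear quot_mod N -> V}, forall u, g (quot_proj N u) = f u.
Proof.
move=> fN.
have fE u : f (repr (quot_proj N u)) = f u.
  by apply/eqP; rewrite -subr_eq0 -linearB fN//; apply/quot_proj_eq/quot_projK.
have g_lin : linear (fun q : quot_mod N => f (repr q)).
  move=> r p q; rewrite -(quot_projK p) -(quot_projK q) -linearP.
  by rewrite !fE linearP.
by exists (mk_linear g_lin).
Qed.

(** Both maps factor through U / ker d, where [d] becomes injective. *)
Lemma injective_extend U V W (d : {linear U -> V}) (f : {linear U -> W}) :
  injective_module W -> (forall u, d u = 0 -> f u = 0) ->
  exists g : {linear V -> W}, forall u, g (d u) = f u.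
Proof.
move=> injW df.
have dker u : u \in kernel d -> d u = 0 by move/eqP.
have fker u : u \in kernel d -> f u = 0 by move/dker/df.
have [d' d'E] := quot_factor dker; have [f' f'E] := quot_factor fker.
have d'I : injective d'.
  move=> p q; rewrite -(quot_projK p) -(quot_projK q) !d'E => dpq.
  by apply/quot_proj_eq; rewrite unfold_in linearB dpq subrr.
have [g gE] := injW _ _ d' f' d'I.
by exists g => u; rewrite -d'E gE f'E.
Qed.

Lemma injective_prod U V :
  injective_module U -> injective_module V -> injective_module (U * V)%type.
Proof.
move=> injU injV A B j f jI.
have [g gE] := injU _ _ j (fst \o f) jI; have [h hE] := injV _ _ j (snd \o f) jI.
have gh_lin : linear (fun b => (g b, h b)) by move=> r x y; rewrite /= !linearP.
by exists (mk_linear gh_lin) => x /=; rewrite gE hE -surjective_pairing.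
Qed.

End Linear.

Section Noetherian.
Variable R : comPzRingType.
Hypothesis noethR : noetherian R.

(** The union of the chain is an ideal, and its finitely many generators already lie in one
    [J k]. *)
Lemma noetherian_acc (J : nat -> {pred R^o}) :
  (forall k, submod_closed (J k)) -> (forall k, {subset J k <= J k.+1}) ->
  exists k, {subset J k.+1 <= J k}.
Proof.
move=> Jc JS.
have Jle k l : (k <= l)%N -> {subset J k <= J l}.
  by move=> /subnK <-; elim: (l - k)%N => // m IHm r /IHm /JS.
have Uc : submod_closed (fun r : R^o => `[< exists k, r \in J k >] : bool).
  split; first by apply/asboolP; exists 0%N; case: (Jc 0%N).
  move=> c u v /asboolP[k uk] /asboolP[l vl]; apply/asboolP; exists (maxn k l).
  case: (Jc (maxn k l)) => _; apply.
    by apply: Jle uk; rewrite leq_maxl.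
  by apply: Jle vl; rewrite leq_maxr.
have [s sE] := noethR (mk_submod Uc).
have [k sk] : exists k, forall r, r \in s -> r \in J k.
  have : forall r, r \in s -> exists k, r \in J k.
    move=> r rs; apply/asboolP; rewrite -[asbool _]/(r \in mk_submod Uc) sE.
    exact: mem_submod_span.
  elim: s {sE} => [|r s IHs] sJ; first by exists 0%N.
  have [|k kP] := IHs; first by move=> u us; apply: sJ; rewrite inE us orbT.
  have [l lP] := sJ r (mem_head _ _).
  exists (maxn k l) => u; rewrite inE => /predU1P[->|/kP uk].
    by apply: Jle lP; rewrite leq_maxr.
  by apply: Jle uk; rewrite leq_maxl.
exists k => r rk.
have : r \in mk_submod Uc by apply/asboolP; exists k.+1.
by rewrite sE => /(@submod_span_min _ _ _ (mk_submod (Jc k))); apply.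
Qed.

End Noetherian.

(** * Torsion submodules of injective modules *)

Section MaximalComplement.
Variables (R : comPzRingType) (A B C : lmodType R).
Variables (j : {linear A -> B}) (f : {linear A -> C}).

(** Zorn's lemma for the submodules whose preimage under [j] lies in ker f. The second property
    expresses maximality: [b] is in [N] as soon as adjoining it keeps that inclusion. *)
Lemma maximal_submod_avoiding : (forall x, j x = 0 -> f x = 0) ->
  exists N : submodClosed B, (forall x, j x \in N -> f x = 0) /\
    forall b, (forall x q r, q \in N -> j x = r *: b + q -> f x = 0) -> b \in N.
Proof.
move=> jf.
pose good (S : set B) := [/\ S 0, forall r u v, S u -> S v -> S (r *: u + v)
  & forall x, S (j x) -> f x = 0].
(* The guard admits the empty set, which is the union of the empty chain. *)
pose P (S : set B) := (S !=set0)%classic -> good S.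
have [|S [PS Smax]] := @Zorn_bigcup _ P.
  move=> F FP Ftot [p [G FG Gp]].
  have gF H u : F H -> H u -> good H by move=> FH Hu; apply: FP => //; exists u.
  split.
  - by have [G0 _ _] := gF _ _ FG Gp; exists G.
  - move=> r u v [H FH Hu] [K FK Kv].
    case: (Ftot _ _ FH FK) => sub.
      by exists K => //; have [_ KD _] := gF _ _ FK Kv; apply: KD => //; exact: sub.
    by exists H => //; have [_ HD _] := gF _ _ FH Hu; apply: HD => //; exact: sub.
  - by move=> x [H FH Hx]; have [_ _ Hj] := gF _ _ FH Hx; exact: Hj.
have SN0 : (S !=set0)%classic.
  apply/set0P/negP => /eqP SE; apply: (Smax [set 0]%classic).
    by rewrite SE; split; [exact: sub0set|move=> /(_ 0 erefl)].
  by move=> _; split=> [//|r u v -> ->|x /jf //]; rewrite scaler0 addr0.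
have [S0 SD Sj] := PS SN0.
have Nc : submod_closed (fun b => `[< S b >] : bool).
  split; first exact/asboolP.
  by move=> r u v /asboolP Su /asboolP Sv; apply/asboolP/SD.
exists (mk_submod Nc); split=> [x /asboolP/Sj //|b bP]; apply/asboolP.
pose S' : set B := [set u | exists r q, S q /\ u = r *: b + q]%classic.
apply: contrapT => Sb; apply: (Smax S').
  split; first by move=> q Sq; exists 0, q; rewrite scale0r add0r.
  by move=> sub; apply/Sb/sub; exists 1, 0; rewrite scale1r addr0.
move=> _; split.
- by exists 0, 0; rewrite scale0r add0r.
- move=> r _ _ [s [q [Sq ->]]] [s' [q' [Sq' ->]]].
  exists (r * s + s'), (r *: q + q'); split; first exact: SD.
  by rewrite scalerDr scalerDl !scalerA addrACA.
- by move=> x [r [q [Sq jx]]]; apply: bP jx; exact/asboolP.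
Qed.

End MaximalComplement.

Section Torsion.
Variables (R : comPzRingType) (a : submodClosed R^o).

Lemma torsionP (V : lmodType R) (v : V) : v \in @torsion_pred R a V <->
  exists t, forall r : R, r \in ideal_exp a t -> r *: v = 0.
Proof.
split=> [/asboolP[t /asboolP tv]|[t tv]].
  by exists t => r /tv /eqP.
by apply/asboolP; exists t; apply/asboolP => r /tv /eqP.
Qed.

Lemma torsion_linear (V W : lmodType R) (f : {linear V -> W}) v :
  v \in @torsion_pred R a V -> f v \in @torsion_pred R a W.
Proof. by move=> vT; exact: (torsion_map_subproof f (Submod vT)). Qed.

Lemma torsion_pair (V W : lmodType R) (v : V) (w : W) :
  v \in @torsion_pred R a V -> w \in @torsion_pred R a W ->
  (v, w) \in @torsion_pred R a (V * W)%type.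
Proof.
move=> vT wT.
have inl_lin : linear (fun u : V => (u, 0 : W)).
  by move=> r x y; rewrite -[RHS]/(r *: x + y, r *: 0 + 0) scaler0 addr0.
have inr_lin : linear (fun u : W => (0 : V, u)).
  by move=> r x y; rewrite -[RHS]/(r *: 0 + 0, r *: x + y) scaler0 addr0.
have -> : (v, w) = mk_linear inl_lin v + mk_linear inr_lin w.
  by rewrite -[RHS]/(v + 0, 0 + w) addr0 add0r.
by rewrite rpredD ?torsion_linear.
Qed.

Lemma ideal_exp_submod t : submod_closed (ideal_exp a t).
Proof. by case: t => [|t]; [split|exact: submod_span_closed]. Qed.

Lemma ideal_expSM t (r s : R) :
  r \in a -> s \in ideal_exp a t -> r * s \in ideal_exp a t.+1.
Proof.
by move=> ra st; apply: mem_submod_span; apply/asboolP; exists r, s.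
Qed.

Lemma ideal_exp_expr k (f : R) : f \in a -> f ^+ k \in ideal_exp a k.
Proof. by move=> fa; elim: k => // k IHk; rewrite exprS ideal_expSM. Qed.

Hypothesis noethR : noetherian R.

(** The annihilators [J s] of a^s v ascend, so J (s+1) is contained in J s for some s. If 1 were not
    in J s, there would be u outside J s with a u inside it; then a^{s+1} u kills v, so u lies in J
    (s+1), a contradiction. *)
Lemma torsion_of_powers (V : lmodType R) (v : V) :
  (forall f : R, f \in a -> exists k, f ^+ k *: v = 0) -> v \in @torsion_pred R a V.
Proof.
move=> vP.
pose J s : {pred R^o} :=
  fun u => `[< forall t : R, t \in ideal_exp a s -> (t * u) *: v = 0 >].
have Jc s : submod_closed (J s).
  split; first by apply/asboolP => t _; rewrite mulr0 scale0r.
  move=> c x y /asboolP xJ /asboolP yJ; apply/asboolP => t ts.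
  by rewrite mulrDr scalerDl yJ// mulrCA -scalerA xJ// scaler0 addr0.
have JS s : {subset J s <= J s.+1}.
  by move=> u /asboolP uJ; apply/asboolP => t /(@ideal_exp_le _ _ s)/uJ; apply.
have [s sP] := noetherian_acc noethR Jc JS.
suff /asboolP J1 : 1 \in J s.
  by apply/torsionP; exists s => r /J1; rewrite mulr1.
apply: contrapT => J1; have [l lE] := noethR a.
(* u is a product of powers of the generators: multiply by each one as long as *)
(* the result stays outside J s.                                               *)
have [u uJ ul] : exists2 u : R, u \notin J s & forall g : R, g \in l -> g * u \in J s.
  have : forall g : R, g \in l -> g \in a.
    by move=> g gl; rewrite lE; exact: mem_submod_span.
  elim: (l) => [|g l' IHl] la; first by exists 1 => //; apply/negP.
  have [|u uJ ul] := IHl; first by move=> h hl; apply: la; rewrite inE hl orbT.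
  have ga : g \in a by apply: la; rewrite mem_head.
  have exk : exists k, g ^+ k * u \in J s.
    have [k gk] := vP g ga; exists k; apply/asboolP => t _.
    by rewrite mulrCA mulrC -scalerA gk scaler0.
  case: (ex_minnP exk) => -[|k] kJ kmin; first by rewrite mul1r (negPf uJ) in kJ.
  exists (g ^+ k * u); first by apply/negP => /kmin; rewrite ltnn.
  move=> h; rewrite inE => /predU1P[->|hl]; first by rewrite mulrA -exprS.
  by rewrite mulrCA; case: (Jc s) => J0 JD; rewrite -[_ * _]addr0 JD ?ul.
move/negP: uJ; apply; apply: sP; apply/asboolP.
apply: (@submod_span_ind R R^o _ (fun t : R => (t * u) *: v = 0))
  => [|r x y xP yP|_ /asboolP[r [t' [ra t's ->]]]].
- by rewrite mul0r scale0r.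
- by rewrite mulrDl scalerDl yP -mulrA -scalerA xP scaler0 addr0.
have : r * u \in J s.
  move: ra; rewrite lE; apply: (@submod_span_ind R R^o _ (fun r : R => r * u \in J s)).
  - by rewrite mul0r; case: (Jc s).
  - by move=> c x y xJ yJ; rewrite mulrDl -mulrA; case: (Jc s) => _; apply.
  - exact: ul.
by move=> /asboolP/(_ _ t's); rewrite -[r *: t']/(r * t') mulrCA mulrA.
Qed.

(** For g in a, the ideals of all r with r g^k b in N stabilise at some k, and then g^k b is in N by
    maximality. Indeed, let j x = r g^k b + n. Some g^l kills f x, so r g^{k+l} b is in N; hence r
    g^k b and j x are in N, and f x = 0. *)
Lemma quotient_torsion (A B C : lmodType R) (j : {linear A -> B}) (f : {linear A -> C})
    (N : submodClosed B) :
  (forall x, f x \in @torsion_pred R a C) ->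
  (forall x, j x \in N -> f x = 0) ->
  (forall b, (forall x q r, q \in N -> j x = r *: b + q -> f x = 0) -> b \in N) ->
  forall q : quot_mod N, q \in @torsion_pred R a (quot_mod N).
Proof.
move=> fT Nj Nmax q; rewrite -(quot_projK q); set b := repr q.
apply: torsion_of_powers => g ga.
have jker x : f x = 0 -> j x \in N.
  move=> fx0; apply: Nmax => y n r nN jy.
  have /Nj : j (y - r *: x) \in N by rewrite linearB linearZ /= jy addrC addKr.
  by rewrite linearB linearZ /= fx0 scaler0 subr0.
pose J k : {pred R^o} := fun r => (r * g ^+ k) *: b \in N.
have JE k (r : R) : (r \in J k) = ((r * g ^+ k) *: b \in N) by [].
have Jc k : submod_closed (J k).
  split; first by rewrite JE mul0r scale0r rpred0.
  move=> c x y; rewrite !JE => xJ yJ.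
  by rewrite mulrDl -mulrA scalerDl -scalerA rpredD// rpredZ.
have JS k : {subset J k <= J k.+1}.
  by move=> r; rewrite !JE exprS mulrCA -[g * _ *: b]scalerA; exact: rpredZ.
have [k kS] := noetherian_acc noethR Jc JS.
have Jk l : {subset J (k + l)%N <= J k}.
  elim: l => [|l IHl]; first by rewrite addn0.
  move=> r; rewrite JE addnS exprSr mulrA -[_ * g]mulrC mulrA => rJ.
  rewrite JE.
  have : g * r \in J k by apply: IHl.
  by rewrite JE [g * r]mulrC -mulrA -exprS => rg; apply: kS.
exists k; rewrite -linearZ -(linear0 (@quot_proj R B N)); apply/quot_proj_eq.
rewrite subr0; apply: Nmax => x n r nN jx; apply: Nj.
have [l gl] : exists l, g ^+ l *: f x = 0.
  have /torsionP[l lP] := fT x; exists l; apply: lP; exact: ideal_exp_expr.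
have : r \in J (k + l)%N.
  rewrite JE exprD mulrA mulrC -scalerA.
  have -> : (r * g ^+ k) *: b = j x - n by rewrite jx -scalerA addrK.
  rewrite scalerBr submodB//; last exact: rpredZ.
  by rewrite -[_ *: j x]linearZ jker// linearZ.
by move=> /Jk; rewrite JE jx scalerA => rJ; rewrite rpredD.
Qed.

(* A map A -> torsion I with kernel K is extended to B through B/N, where N is  *)
(* maximal with N cap A = K: B/N is torsion, so any map B/N -> I is a map to    *)
(* torsion I.  This replaces the usual appeal to the Artin-Rees lemma.          *)
Lemma torsion_injective (I : lmodType R) :
  injective_module I -> injective_module (torsion a I).
Proof.
move=> injI A B j f jI.
have [|N [Nj Nmax]] := @maximal_submod_avoiding _ _ _ _ j f.
  by move=> x jx; rewrite (jI x 0) ?linear0.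
have fT x : f x \in @torsion_pred R a (torsion a I).
  have /torsionP[t tP] := submodP (f x).
  by apply/torsionP; exists t => r /tP fx; apply: val_inj.
have NT := quotient_torsion fT Nj Nmax.
have [|g gE] := @injective_extend R _ _ _ (@quot_proj R B N \o j) (val \o f) injI.
  move=> x /=; rewrite -(linear0 (@quot_proj R B N)) => /quot_proj_eq.
  by rewrite subr0 => /Nj ->.
have gT b : g (quot_proj N b) \in @torsion_pred R a I by exact: torsion_linear.
have g_lin : linear (fun b => Submod (gT b)).
  by move=> r u v; apply: val_inj; rewrite /= !linearP.
by exists (mk_linear g_lin) => x; apply: val_inj; exact: gE.
Qed.

End Torsion.

(** * Complexes of injective modules *)

Section Comparison.
Variables (R : comPzRingType) (L X : cochain R).
Hypothesis exactL : forall i x, differential L i.+1 x = 0 ->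
  exists y, x = differential L i y.
Hypothesis injX : forall i, injective_module (X i.+1).

(** Invariant: cocycles go to cocycles. It lets d r_i extend along d to r_{i+1}, and exactness of
    [L] restores it one degree higher. *)
Lemma chain_map_lift (r0 : {linear L 0 -> X 0}) :
  (forall x, differential L 0 x = 0 -> differential X 0 (r0 x) = 0) ->
  exists r : forall i, {linear L i -> X i}, r 0 = r0 /\
    forall i x, r i.+1 (differential L i x) = differential X i (r i x).
Proof.
move=> r0P.
apply: (@dependent_choice_nat (fun i => {linear L i -> X i})
  (fun i r => forall x, differential L i x = 0 -> differential X i (r x) = 0)
  (fun i r r' => forall x, r' (differential L i x) = differential X i (r x))) => //.
move=> i r rP.
have [r' r'E] := injective_extend (f := differential X i \o r) (@injX i) rP.
exists r'; split=> // x /exactL[y ->].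
by rewrite r'E /= differential_comp.
Qed.

(** Invariant: d g_i = d h_i d. It makes g_{i+1} - d h_i vanish on the cocycles of [L], which are
    boundaries, so this map extends along d to h_{i+1}. *)
Lemma null_homotopy (g : forall i, {linear L i -> X i}) (h0 : {linear L 1 -> X 0}) :
  (forall i x, g i.+1 (differential L i x) = differential X i (g i x)) ->
  (forall x, differential X 0 (g 0 x) = differential X 0 (h0 (differential L 0 x))) ->
  exists h : forall i, {linear L i.+1 -> X i}, forall i x,
    g i.+1 x = h i.+1 (differential L i.+1 x) + differential X i (h i x).
Proof.
move=> gd h0P.
have [||h [_ hP]] := @dependent_choice_nat (fun i => {linear L i.+1 -> X i})
  (fun i h => forall x,
     differential X i (g i x) = differential X i (h (differential L i x)))
  (fun i h h' => forall x,
     g i.+1 x = h' (differential L i.+1 x) + differential X i (h x)) h0; last by exists h.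
  exact: h0P.
move=> i h hP.
have [|h' h'E] := injective_extend (d := differential L i.+1)
    (f := g i.+1 \- (differential X i \o h)) (@injX i).
  by move=> x /exactL[y ->] /=; rewrite gd hP subrr.
exists h'; split=> x; rewrite h'E /= ?subrK//.
by rewrite linearB differential_comp subr0.
Qed.

End Comparison.

(* Extending the identity of ker d^0 to a chain map L -> torsion L and comparing *)
(* it with the identity of L by a homotopy; homotopies preserve torsion elements. *)
Lemma torsion_exact (R : comPzRingType) (a : submodClosed R^o) (L : cochain R) :
  noetherian R -> (forall i, injective_module (L i)) ->
  (forall x, differential L 0 x = 0 -> x \in @torsion_pred R a (L 0)) ->
  (forall i x, differential L i.+1 x = 0 -> exists y, x = differential L i y) ->
  forall i z, z \in @torsion_pred R a (L i.+1) -> differential L i.+1 z = 0 ->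
  exists2 y, y \in @torsion_pred R a (L i) & z = differential L i y.
Proof.
move=> noethR injL kerT exactL i z zT dz.
have injT j : injective_module (torsion_cochain a L j) by exact: torsion_injective.
have ker0 (u : submod (kernel (differential L 0))) : differential L 0 (val u) = 0.
  exact/eqP/(submodP u).
pose incl u : torsion a (L 0) := Submod (kerT _ (ker0 u)).
have incl_lin : linear incl by move=> r u v; exact: val_inj.
have [r0 r0E] := injT 0 _ _ (val : {linear submod (kernel (differential L 0)) -> _})
  (mk_linear incl_lin) val_inj.
have r0K x : differential L 0 x = 0 -> val (r0 x) = x.
  move=> dx; have xK : x \in kernel (differential L 0) by exact/eqP.
  by rewrite (r0E (Submod xK)).
have [|r [r_0 rd]] := chain_map_lift exactL (fun j => injT j.+1) (r0 := r0).
  by move=> x dx; apply: val_inj; rewrite /= r0K.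
pose g j : {linear L j -> L j} := (val \o r j) \- idfun.
have gd j x : g j.+1 (differential L j x) = differential L j (g j x).
  by rewrite /= rd linearB.
have [|h0 h0E] := injective_extend (d := differential L 0) (f := g 0) (injL 0).
  by move=> x dx; rewrite /= r_0 r0K// subrr.
have [|h hE] := null_homotopy exactL (fun j => injL j.+1) gd (h0 := h0).
  by move=> x; rewrite h0E.
have [y zy] := exactL _ _ dz.
(* As dz = 0, the homotopy gives r z - z = d (h z), while z = d y gives r z = d (r y). *)
exists (val (r i y) - h i z); first by rewrite submodB ?submodP ?torsion_linear.
rewrite linearB -[differential L i (val _)]/(val (differential (torsion_cochain a L) i _)).
rewrite -rd -zy; have := hE i z; rewrite dz linear0 add0r => <- /=.
by rewrite opprB addrC subrK.
Qed.

(** * Comparison of M and M/xM *)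

Section TorsionCohomology.
Variables (R : comPzRingType) (a : submodClosed R^o) (C : cochain R).

(** The coboundaries of [torsion_cochain a C], phrased in [C] so that cocycles and primitives are
    plain elements of [C]. *)
Definition torsion_coboundary j : C j -> Prop :=
  match j return C j -> Prop with
  | 0 => fun z => z = 0
  | i.+1 => fun z => exists2 y, y \in @torsion_pred R a (C i) & z = differential C i y
  end.

Lemma torsion_coboundary_closed j r (z t : C j) :
  torsion_coboundary z -> torsion_coboundary t -> torsion_coboundary (r *: z + t).
Proof.
case: j z t => [|j] z t; first by move=> -> ->; rewrite scaler0 addr0.
move=> [y yT ->] [y' yT' ->]; exists (r *: y + y'); last by rewrite linearP.
by rewrite rpredD ?rpredZ.
Qed.

Lemma torsion_coboundary0 j : @torsion_coboundary j 0.
Proof. by case: j => [//|j]; exists 0; rewrite ?rpred0 ?linear0. Qed.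

Lemma torsion_coboundaryD j (z t : C j) :
  torsion_coboundary z -> torsion_coboundary t -> torsion_coboundary (z + t).
Proof. by rewrite -[z in X in _ -> _ -> X]scale1r; exact: torsion_coboundary_closed. Qed.

Let H j : lmodType R := cohomology (torsion_cochain a C) j.

Let class_eq0 j (z : submod (cocycle (C := torsion_cochain a C) (i := j))) r :
  r *: (quot_proj _ z : H j) = 0 <-> torsion_coboundary (r *: val (val z)).
Proof.
rewrite -(linear0 (@quot_proj _ _ (boundary_cocycle (C := torsion_cochain a C) (i := j)))).
rewrite -[r *: _]linearZ quot_proj_eq subr0.
rewrite -[_ \in _]/(val (r *: z) \in coboundary (C := torsion_cochain a C) (i := j)).
case: j z => [|j] z.
  split=> [/eqP/(congr1 val)//|rz]; first exact/eqP/val_inj.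
split=> [/asboolP[y /(congr1 val) rz]|[y yT rz]].
  by exists (val y); [exact: submodP|].
by apply/asboolP; exists (Submod yT); apply: val_inj.
Qed.

Lemma cohomology_class j (z : C j) :
  z \in @torsion_pred R a (C j) -> differential C j z = 0 ->
  exists q : H j, forall r, r *: q = 0 <-> torsion_coboundary (r *: z).
Proof.
move=> zT dz.
have zC : Submod zT \in cocycle (C := torsion_cochain a C) (i := j).
  by apply/eqP/val_inj.
by exists (quot_proj _ (Submod zC)) => r; exact: class_eq0.
Qed.

Lemma cohomology_repr j (q : H j) : exists z : C j,
  [/\ z \in @torsion_pred R a (C j), differential C j z = 0
    & forall r, r *: q = 0 <-> torsion_coboundary (r *: z)].
Proof.
exists (val (val (repr q))); split; first exact: submodP.
  by have /eqP/(congr1 val) := submodP (repr q).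
by move=> r; rewrite -{1}(quot_projK q); exact: class_eq0.
Qed.

End TorsionCohomology.

Section Cone.
Variables (R : comPzRingType) (C : cochain R) (x : R).

Fact cone_diff_linear j : linear (fun u : (C j.+1 * C j)%type =>
  (differential C j.+1 u.1, x *: u.1 - differential C j u.2)).
Proof.
move=> r [u1 u2] [v1 v2]; congr (_, _) => /=; first exact: linearP.
by rewrite linearP scalerDr scalerBr opprD !scalerA [x * r]mulrC addrACA.
Qed.

Fact cone_diff_comp j u :
  mk_linear (@cone_diff_linear j.+1) (mk_linear (@cone_diff_linear j) u) = 0.
Proof.
rewrite -[RHS]/(0, 0); congr (_, _) => /=; first exact: differential_comp.
by rewrite linearB linearZ /= differential_comp subr0 subrr.
Qed.

(* The mapping cone of x : C -> C, without its component C^0 in degree -1. *)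
Definition cone : cochain R := Cochain cone_diff_comp.

End Cone.

Section ConeComparison.
Variables (R : comPzRingType) (a : submodClosed R^o) (x : R).
Variables (M N : lmodType R) (p : {linear M -> N}).
Hypothesis noethR : noetherian R.
Hypothesis p_surj : forall n, exists m, p m = n.
Hypothesis p_ker : forall m, p m = 0 <-> exists m', m = x *: m'.
Hypothesis x_tors : forall m : M, x *: m = 0 -> m \in @torsion_pred R a M.
Variables (E : injective_resolution M) (F : injective_resolution N).

Let K : cochain R := cone E x.
Let aug := augmentation E.

Let augE m : differential E 0 (aug m) = 0.
Proof. by apply/augmentation_exact; exists m. Qed.

Let xE i (e : E i) : differential E i (x *: e) = x *: differential E i e.
Proof. exact: linearZ. Qed.

(** The pair (dy, xy) is the boundary of y from the omitted degree -1; the remaining (0, aug m)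
    represents the class of m in M/xM. *)
Let cone_exact0 (u : K 0) : differential K 0 u = 0 ->
  exists y m, u = (differential E 0 y, x *: y + aug m).
Proof.
case: u => e c dec; have de : differential E 1 e = 0 := congr1 fst dec.
have dc : x *: e - differential E 0 c = 0 := congr1 snd dec.
have [y ey] := (resolution_exact _).1 de.
have [m cm] : exists m, c - x *: y = aug m.
  by apply/augmentation_exact/eqP; rewrite linearB xE -ey -oppr_eq0 opprB dc.
by exists y, m; rewrite -ey -cm addrC subrK.
Qed.

Let cone_exact i (u : K i.+1) : differential K i.+1 u = 0 ->
  exists v, u = differential K i v.
Proof.
case: u => e c dec; have de : differential E i.+2 e = 0 := congr1 fst dec.
have dc : x *: e - differential E i.+1 c = 0 := congr1 snd dec.
have [y ey] := (resolution_exact _).1 de.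
have [w cw] : exists w, x *: y - c = differential E i w.
  by apply/resolution_exact; rewrite linearB xE -ey.
by exists (y, w); congr (_, _) => //=; rewrite -cw opprB addrC subrK.
Qed.

(** The prescription on the cocycles of K^0 is consistent: if (dy, xy + aug m) = 0, then y = aug m'
    and m = - x m', so p m = 0. Injectivity of [F] extends it to K^0 and then to all degrees. *)
Lemma cone_chain_map : exists psi : forall i, {linear K i -> F i},
  (forall i u, psi i.+1 (differential K i u) = differential F i (psi i u)) /\
  forall y m, psi 0 (differential E 0 y, x *: y + aug m) = augmentation F (p m).
Proof.
have d_lin : linear (fun u : (E 0 * M)%type =>
    (differential E 0 u.1, x *: u.1 + aug u.2) : K 0).
  move=> r [u1 u2] [v1 v2]; congr (_, _) => /=; first exact: linearP.
  by rewrite linearP !scalerDr !scalerA [x * r]mulrC addrACA.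
pose f : {linear (E 0 * M)%type -> F 0} := augmentation F \o (p \o snd).
have [|psi0 psi0E] := injective_extend (d := mk_linear d_lin) (f := f)
    (@resolution_injective _ _ F 0).
  move=> [y m] dym /=.
  have dy : differential E 0 y = 0 := congr1 fst dym.
  have xy : x *: y + aug m = 0 := congr1 snd dym.
  have [m' ym'] := (augmentation_exact _).1 dy.
  have -> : p m = 0.
    apply/p_ker; exists (- m'); apply: (@augmentation_inj _ _ E); apply/eqP.
    by rewrite scalerN linearN linearZ /= -ym' -addr_eq0 addrC xy.
  exact: linear0.
have psi0P y m : psi0 (differential E 0 y, x *: y + aug m) = augmentation F (p m).
  exact: (psi0E (y, m)).
have [|psi [psi_0 psid]] := chain_map_lift cone_exact
    (fun i => @resolution_injective _ _ F i.+1) (r0 := psi0).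
  move=> u /cone_exact0[y [m ->]]; rewrite psi0P.
  by apply/augmentation_exact; exists (p m).
by exists psi; rewrite psi_0.
Qed.

Section Total.
Variable psi : forall i, {linear K i -> F i}.
Hypothesis psid : forall i u,
  psi i.+1 (differential K i u) = differential F i (psi i u).
Hypothesis psi0 : forall y m,
  psi 0 (differential E 0 y, x *: y + aug m) = augmentation F (p m).

(** The shifted cone of [psi]: degree i is K^{i-1} x F^{i-2}, with E^0 restored as K^{-1}. *)
Let obj i : lmodType R :=
  match i with 0 => E 0 | 1 => K 0 | j.+2 => (K j.+1 * F j)%type end.

Let diff0 (e : E 0) : K 0 := (differential E 0 e, x *: e).

Let diff0_linear : linear diff0.
Proof.
move=> r u v; congr (_, _) => /=; first exact: linearP.
by rewrite scalerDr !scalerA mulrC.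
Qed.

Let diff1 (u : K 0) : (K 1 * F 0)%type := (differential K 0 u, psi 0 u).

Let diff1_linear : linear diff1.
Proof. by move=> r u v; congr (_, _); exact: linearP. Qed.

Let diff2 j (u : (K j.+1 * F j)%type) : (K j.+2 * F j.+1)%type :=
  (differential K j.+1 u.1, psi j.+1 u.1 - differential F j u.2).

Let diff2_linear j : linear (@diff2 j).
Proof.
move=> r [u1 u2] [v1 v2]; congr (_, _); first exact: linearP.
rewrite -[LHS]/(psi j.+1 (r *: u1 + v1) - differential F j (r *: u2 + v2)).
rewrite -[RHS]/(r *: (psi j.+1 u1 - differential F j u2)
  + (psi j.+1 v1 - differential F j v2)).
by rewrite (linearP (psi j.+1)) (linearP (differential F j)) scalerBr opprD addrACA.
Qed.

Let diff i : {linear obj i -> obj i.+1} :=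
  match i return {linear obj i -> obj i.+1} with
  | 0 => mk_linear diff0_linear
  | 1 => mk_linear diff1_linear
  | j.+2 => mk_linear (@diff2_linear j)
  end.

Let psi_diff0 e : psi 0 (diff0 e) = 0.
Proof.
by rewrite /diff0 -[x *: e]addr0 -(linear0 aug) psi0 !linear0.
Qed.

Let cone_diff0 e : differential K 0 (diff0 e) = 0.
Proof. by congr (_, _) => /=; rewrite ?differential_comp// xE subrr. Qed.

Let diff_comp i u : diff i.+1 (diff i u) = 0.
Proof.
case: i u => [|[|j]] u; rewrite -[RHS]/(0, 0); congr (_, _).
- exact: cone_diff0.
- exact: psi_diff0.
- exact: (differential_comp (c := K)).
- by rewrite -[LHS]/(psi 1 (differential K 0 u) - differential F 0 (psi 0 u)) psid subrr.
- exact: (differential_comp (c := K)).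
- rewrite -[LHS]/(psi j.+2 (differential K j.+1 u.1)
    - differential F j.+1 (psi j.+1 u.1 - differential F j u.2)).
  by rewrite linearB psid differential_comp subr0 subrr.
Qed.

(* An injective resolution of the kernel of x on M. *)
Let total : cochain R := Cochain diff_comp.

Let total_injective i : injective_module (total i).
Proof.
have injE := @resolution_injective _ _ E; have injF := @resolution_injective _ _ F.
have injK j : injective_module (K j) by exact: injective_prod.
case: i => [|[|j]]; [exact: injE | exact: injK | exact: injective_prod (injK _) (injF _)].
Qed.

Let total_ker u : differential total 0 u = 0 -> u \in @torsion_pred R a (total 0).
Proof.
move=> du; have de : differential E 0 u = 0 := congr1 fst du.
have xu : x *: u = 0 := congr1 snd du.
have [m um] := (augmentation_exact _).1 de.
rewrite um; apply/torsion_linear/x_tors/(@augmentation_inj _ _ E).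
by rewrite linearZ /= linear0 -xu um.
Qed.

Let total_exact i u : differential total i.+1 u = 0 ->
  exists y, u = differential total i y.
Proof.
case: i u => [|[|j]] u du.
- have /cone_exact0[y [m um]] : differential K 0 u = 0 := congr1 fst du.
  have : psi 0 u = 0 := congr1 snd du.
  rewrite um psi0 -(linear0 (augmentation F)) => /augmentation_inj/p_ker[m' mm'].
  exists (y + aug m'); rewrite mm' linearZ /= -scalerDr; congr (_, _).
  by rewrite linearD augE addr0.
- case: u du => u f du.
  have /cone_exact[v uv] : differential K 1 u = 0 := congr1 fst du.
  have duf : psi 1 u - differential F 0 f = 0 := congr1 snd du.
  (* The defect psi v - f comes from some n = p m; subtracting the cocycle (0, aug m) from v removes
     it and leaves dv unchanged. *)
  have [n vn] : exists n, psi 0 v - f = augmentation F n.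
    by apply/augmentation_exact; rewrite linearB -psid -uv.
  have [m mn] := p_surj n.
  have dm : differential K 0 (0, aug m) = 0.
    by congr (_, _) => /=; rewrite ?augE linear0 ?subr0.
  exists (v - (0, aug m)); congr (_, _).
    by rewrite linearB dm subr0.
  have psim : psi 0 (0, aug m) = augmentation F n.
    have := psi0 0 m; by rewrite linear0 scaler0 add0r mn.
  by rewrite linearB /= psim -vn opprB addrC subrK.
- case: u du => u f du.
  have /cone_exact[v uv] : differential K j.+2 u = 0 := congr1 fst du.
  have duf : psi j.+2 u - differential F j.+1 f = 0 := congr1 snd du.
  have [f' vf] : exists f', psi j.+1 v - f = differential F j f'.
    by apply/resolution_exact; rewrite linearB -psid -uv.
  by exists (v, f'); congr (_, _) => //=; rewrite -vf opprB addrC subrK.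
Qed.

Let total_torsion_exact := torsion_exact noethR total_injective total_ker total_exact.

(** The pair (0, f) is a torsion cocycle of [total]; a torsion primitive of it provides u. *)
Lemma cone_torsion_surj j (f : F j) :
  f \in @torsion_pred R a (F j) -> differential F j f = 0 ->
  exists u : K j, [/\ u \in @torsion_pred R a (K j), differential K j u = 0
    & torsion_coboundary a (psi j u - f)].
Proof.
move=> fT df.
have zT : (0, f) \in @torsion_pred R a (total j.+2).
  by apply: torsion_pair => //; exact: rpred0.
have dz : differential total j.+2 (0, f) = 0.
  rewrite -[LHS]/(differential K j.+1 0, psi j.+1 0 - differential F j f).
  by rewrite !linear0 df subr0.
have [u uT uE] := total_torsion_exact zT dz.
case: j f fT df zT dz u uT uE => [|j] f fT df zT dz u uT uE.
  exists u; split=> //; first exact/esym/(congr1 fst uE).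
  by rewrite -(congr1 snd uE : f = psi 0 u) subrr.
exists u.1; split; first exact: (torsion_linear fst uT).
  exact/esym/(congr1 fst uE).
exists u.2; first exact: (torsion_linear snd uT).
by rewrite (congr1 snd uE : f = psi j.+1 u.1 - differential F j u.2) opprB addrC subrK.
Qed.

(** The coboundaries of the full cone of x on the torsion complex. In degree 0 they include those
    coming from E^0, which [cone] omits. *)
Definition cone_coboundary j (u : K j) :=
  exists2 v, v \in @torsion_pred R a (E j) &
    u.1 = differential E j v /\ torsion_coboundary a (u.2 - x *: v).

(** In degree 0, u itself is a cocycle of [total]; in higher degrees psi u = d f makes (u, f) one.
    The cone component of a torsion primitive then bounds u. *)
Lemma cone_torsion_inj j (u : K j) :
  u \in @torsion_pred R a (K j) -> differential K j u = 0 ->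
  torsion_coboundary a (psi j u) -> cone_coboundary u.
Proof.
case: j u => [|j] u uT du.
  move=> psiu; have [||v vT uE] := total_torsion_exact (i := 0) (z := u) => //.
    by congr (_, _).
  by exists v => //; rewrite uE /= subrr.
move=> [f fT uf].
have zT : (u, f) \in @torsion_pred R a (total j.+2) by exact: torsion_pair.
have [|v vT uE] := total_torsion_exact zT.
  by congr (_, _) => //=; rewrite uf subrr.
have [w wT {}uE] : exists2 w : K j, w \in @torsion_pred R a (K j) &
    u = differential K j w.
  case: j u f v vT uE {du fT uf zT uT} => [|j] u f v vT uE.
    by exists v => //; exact: (congr1 fst uE).
  by exists v.1; [exact: (torsion_linear fst vT)|exact: (congr1 fst uE)].
exists w.1; first exact: (torsion_linear fst wT).
rewrite uE; split=> //=; exists (- w.2).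
  by rewrite -scaleN1r rpredZ// (torsion_linear snd wT).
by rewrite addrAC subrr add0r linearN.
Qed.

Lemma psi_cone_coboundary j (u : K j) : cone_coboundary u -> torsion_coboundary a (psi j u).
Proof.
case: j u => [|j] [u1 u2] [v vT [/= -> uB]].
  have -> : u2 = x *: v by apply/eqP; rewrite -subr_eq0 uB.
  exact: psi_diff0.
have [w wT uw] := uB.
have -> : (differential E j.+1 v, u2) = differential K j (v, - w).
  by congr (_, _) => /=; rewrite linearN opprK -uw addrC subrK.
exists (psi j (v, - w)); last exact: psid.
apply: torsion_linear; apply: torsion_pair => //.
by rewrite -scaleN1r rpredZ.
Qed.

End Total.

(** [psi] induces an isomorphism from the torsion cohomology of the full cone to that of [F];
    annihilation by r is all that has to be transported. *)
Lemma cone_cohomology j r :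
  (forall f : F j, f \in @torsion_pred R a (F j) -> differential F j f = 0 ->
     torsion_coboundary a (r *: f)) <->
  (forall u : K j, u \in @torsion_pred R a (K j) -> differential K j u = 0 ->
     cone_coboundary (r *: u)).
Proof.
have [psi [psid psi0]] := cone_chain_map.
split=> rB.
  move=> u uT du; apply: (cone_torsion_inj psid psi0).
  - exact: rpredZ.
  - by rewrite linearZ_LR du scaler0.
  - rewrite linearZ; apply: rB; first exact: torsion_linear.
    by rewrite -psid du linear0.
move=> f fT df; have [u [uT du uf]] := cone_torsion_surj psid psi0 fT df.
have := psi_cone_coboundary psid psi0 (rB u uT du).
have -> : r *: f = - r *: (psi j u - f) + psi j (r *: u).
  by rewrite scaleNr -scalerN opprB scalerBr linearZ_LR subrK.
exact: torsion_coboundary_closed.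
Qed.

End ConeComparison.

(** * Annihilation of local cohomology *)

Section SquareOfIdeal.
Variables (R : comPzRingType) (a : submodClosed R^o) (x : R).
Hypothesis x_a2 : x \in ideal_exp a 2.

Lemma ideal_exp1_sub : {subset ideal_exp a 1 <= a}.
Proof.
apply: submod_span_min => _ /asboolP[r [v [ra _ ->]]].
by rewrite -[r *: v]/(r * v) mulrC; exact: rpredZ.
Qed.

Lemma ideal_exp2_ind (P : R -> Prop) :
  P 0 -> (forall c r s, P r -> P s -> P (c * r + s)) ->
  (forall r s : R, r \in a -> s \in a -> P (r * s)) -> P x.
Proof.
move=> P0 PD PM; move: x_a2.
apply: (@submod_span_ind R R^o _ P) => // _ /asboolP[r [v [ra /ideal_exp1_sub va ->]]].
exact: PM.
Qed.

(** Descent on t with a^t v = 0. If a^{t+2} v = 0 and u is in a^t, then x u is in a^{t+2}, so x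
    kills u v and hence a does; thus a^{t+1} v = 0. *)
Lemma annihilates_of_kernel (V : lmodType R) :
  (forall v : V, v \in @torsion_pred R a V) ->
  (forall v : V, x *: v = 0 -> forall r : R, r \in a -> r *: v = 0) ->
  annihilates a V.
Proof.
move=> VT xV r ra v; have /torsionP[t] := VT v.
elim: t v r ra => [|[|t] IHt] v r ra tv.
- by rewrite -[v]scale1r tv ?scaler0.
- by apply: tv; rewrite -[r]mulr1; exact: (ideal_expSM ra (s := 1)).
apply: IHt => //.
apply: (@submod_span_ind R R^o _ (fun r : R => r *: v = 0)).
- exact: scale0r.
- by move=> c s s' sv s'v; rewrite scalerDl s'v addr0 -[c *: s]/(c * s) -scalerA sv scaler0.
move=> _ /asboolP[s [u [sa ut ->]]]; rewrite -[s *: u]/(s * u) -scalerA; apply: xV => //.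
rewrite scalerA; apply: tv.
apply: (ideal_exp2_ind (P := fun x : R => x * u \in ideal_exp a t.+2)).
- by rewrite mul0r; case: (ideal_exp_submod a t.+2).
- move=> c y z yt zt; rewrite mulrDl -mulrA.
  by case: (ideal_exp_submod a t.+2) => _; apply.
- by move=> y z ya za; rewrite -mulrA !ideal_expSM.
Qed.

End SquareOfIdeal.

Section Annihilation.
Variables (R : comPzRingType) (a : submodClosed R^o).

Lemma annihilates_cohomology (C : cochain R) j :
  annihilates a (cohomology (torsion_cochain a C) j) <->
  forall r : R, r \in a -> forall z : C j, z \in @torsion_pred R a (C j) ->
    differential C j z = 0 -> torsion_coboundary a (r *: z).
Proof.
split=> aH r ra.
  by move=> z zT dz; have [q qE] := cohomology_class zT dz; apply/qE/aH.
by move=> q; have [z [zT dz qE]] := cohomology_repr q; apply/qE/aH.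
Qed.

Lemma cohomology_torsion (C : cochain R) j
    (q : cohomology (torsion_cochain a C) j) : q \in @torsion_pred R a _.
Proof.
have [z [/torsionP[t zt] _ qE]] := cohomology_repr q.
by apply/torsionP; exists t => r /zt rz; apply/qE; rewrite rz; exact: torsion_coboundary0.
Qed.

Variables (x : R) (M : lmodType R) (E : injective_resolution M).
Hypothesis x_a2 : x \in ideal_exp a 2.

Lemma augmentation_torsion_coboundary (m : M) (r : R) :
  torsion_coboundary a (r *: augmentation E m) <-> r *: m = 0.
Proof.
rewrite /= -linearZ; split=> [rm|->]; last exact: linear0.
by apply: (@augmentation_inj _ _ E); rewrite rm linear0.
Qed.

Lemma annihilates_cohomology0 :
  (forall m : M, x *: m = 0 -> forall r : R, r \in a -> r *: m = 0) ->
  annihilates a (cohomology (torsion_cochain a E) 0).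
Proof.
move=> xM; apply: (annihilates_of_kernel x_a2); first exact: cohomology_torsion.
move=> q; have [z [zT dz qE]] := cohomology_repr q.
have [m zm] := (augmentation_exact _).1 dz; rewrite zm in qE.
move=> /qE/augmentation_torsion_coboundary/xM rm r /rm.
by move=> /augmentation_torsion_coboundary/qE.
Qed.

Lemma cohomology0_annihilates (m : M) :
  annihilates a (cohomology (torsion_cochain a E) 0) ->
  m \in @torsion_pred R a M -> forall r : R, r \in a -> r *: m = 0.
Proof.
move=> /annihilates_cohomology aH mT r ra; apply/augmentation_torsion_coboundary.
apply: aH => //; first exact: torsion_linear.
by apply/augmentation_exact; exists m.
Qed.

(** A class of z killed by x, say x z = d w, lifts to the cone cocycle (z, w). Bounding r (z, w)
    bounds r z, so a kills the kernel of x. *)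
Lemma annihilates_cohomologyS j :
  (forall r : R, r \in a -> forall u : cone E x j,
     u \in @torsion_pred R a (cone E x j) -> differential (cone E x) j u = 0 ->
     cone_coboundary a (r *: u)) ->
  annihilates a (cohomology (torsion_cochain a E) j.+1).
Proof.
move=> aK; apply: (annihilates_of_kernel x_a2); first exact: cohomology_torsion.
move=> q; have [z [zT dz qE]] := cohomology_repr q.
move=> /qE[w wT xz] r ra; apply/qE.
have [||v vT [/= rz _]] := aK r ra (z, w).
- exact: torsion_pair.
- by congr (_, _) => //=; rewrite xz subrr.
by exists v.
Qed.

(* For x = b * c and a cocycle y, choose d U = b * c * y through d u = c * y,   *)
(* U = b * u; then [r * u - c * v] is a cocycle whenever d v = r * y, and b     *)
(* makes it a coboundary.                                                       *)
Lemma square_primitive j (y : E j.+1) :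
  annihilates a (cohomology (torsion_cochain a E) j) ->
  annihilates a (cohomology (torsion_cochain a E) j.+1) ->
  y \in @torsion_pred R a (E j.+1) -> differential E j.+1 y = 0 ->
  exists2 u, u \in @torsion_pred R a (E j) & x *: y = differential E j u /\
    forall (r : R) v, r \in a -> v \in @torsion_pred R a (E j) ->
      r *: y = differential E j v -> torsion_coboundary a (r *: u - x *: v).
Proof.
move=> /annihilates_cohomology aH /annihilates_cohomology aHS yT dy.
apply: (ideal_exp2_ind x_a2 (P := fun x : R => exists2 u, u \in @torsion_pred R a (E j)
  & x *: y = differential E j u /\ forall (r : R) v, r \in a ->
    v \in @torsion_pred R a (E j) -> r *: y = differential E j v ->
    torsion_coboundary a (r *: u - x *: v))).
- exists 0; first exact: rpred0.
  split=> [|r v _ _ _]; first by rewrite scale0r linear0.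
  by rewrite scaler0 scale0r subr0; exact: torsion_coboundary0.
- move=> c s t [u uT [su uP]] [w wT [tw wP]]; exists (c *: u + w).
    by rewrite rpredD ?rpredZ.
  split=> [|r v ra vT rv]; first by rewrite scalerDl -scalerA su tw linearP.
  have -> : r *: (c *: u + w) - (c * s + t) *: v
      = c *: (r *: u - s *: v) + (r *: w - t *: v).
    by rewrite scalerDr scalerBr scalerDl opprD !scalerA [r * c]mulrC addrACA.
  by apply: torsion_coboundary_closed; [exact: uP|exact: wP].
move=> b c ba ca; have [u uT cu] := aHS c ca y yT dy.
exists (b *: u); first exact: rpredZ.
split=> [|r v ra vT rv]; first by rewrite linearZ /= -cu scalerA.
have -> : r *: (b *: u) - (b * c) *: v = b *: (r *: u - c *: v).
  by rewrite scalerBr !scalerA [r * b]mulrC.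
apply: aH => //; first by rewrite submodB ?rpredZ.
by rewrite linearB !(linearZ_LR (differential E j)) -cu -rv !scalerA [r * c]mulrC subrr.
Qed.

(** For a cocycle (y, w), both w and the chosen u0 are primitives of x y. So w - u0 is a cocycle,
    whose multiple by r bounds, and u0 was chosen to make r u0 - x v bound. *)
Lemma cone_annihilates j :
  annihilates a (cohomology (torsion_cochain a E) j) ->
  annihilates a (cohomology (torsion_cochain a E) j.+1) ->
  forall r : R, r \in a -> forall u : cone E x j,
    u \in @torsion_pred R a (cone E x j) -> differential (cone E x) j u = 0 ->
    cone_coboundary a (r *: u).
Proof.
move=> aH aHS r ra [y w] uT du.
have yT : y \in @torsion_pred R a (E j.+1) := torsion_linear fst uT.
have wT : w \in @torsion_pred R a (E j) := torsion_linear snd uT.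
have dy : differential E j.+1 y = 0 := congr1 fst du.
have dw : x *: y - differential E j w = 0 := congr1 snd du.
have [u0 u0T [xu uP]] := square_primitive aH aHS yT dy.
move/annihilates_cohomology: aHS => aHS; move/annihilates_cohomology: aH => aH.
have [v vT rv] := aHS r ra y yT dy.
exists v => //; split=> //=.
have -> : r *: w - x *: v = r *: (w - u0) + (r *: u0 - x *: v).
  by rewrite scalerBr addrA subrK.
apply: torsion_coboundaryD; last exact: uP.
apply: aH => //; first exact: submodB.
by rewrite linearB -xu -opprB dw oppr0.
Qed.

End Annihilation.

(** * Weak and filter regular sequences *)

Section PrefixMul.
Variable R : comPzRingType.
Implicit Types (M N : lmodType R) (s : seq R).

HB.instance Definition _ M s i := GRing.SubmodClosed.copy (@prefix_mul R M s i)
  (ideal_mul (submod_span [in take i s : seq R^o]) predT).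

Lemma prefix_mul_nil M s i (m : M) : take i s = [::] ->
  m \in @prefix_mul R M s i <-> m = 0.
Proof.
rewrite /prefix_mul => ->; split=> [|->]; last exact: rpred0.
apply: (@submod_span_ind R M _ (fun m => m = 0)) => //.
  by move=> r u v -> ->; rewrite scaler0 addr0.
move=> _ /asboolP[r [v [r0 _ ->]]].
have -> : r = 0; last exact: scale0r.
move: r0; apply: (@submod_span_ind R R^o _ (fun r => r = 0)) => //.
by move=> c u w -> ->; rewrite scaler0 addr0.
Qed.

Lemma prefix_mul_cons M x s i (m : M) :
  m \in @prefix_mul R M (x :: s) i.+1 <-> exists m', m - x *: m' \in @prefix_mul R M s i.
Proof.
split.
  apply: (@submod_span_ind R M _ (fun m => exists m', m - x *: m' \in @prefix_mul R M s i)).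
  - by exists 0; rewrite scaler0 subr0 rpred0.
  - move=> r u v [u' uP] [v' vP]; exists (r *: u' + v').
    rewrite scalerDr !scalerA mulrC -scalerA opprD addrACA -scalerBr.
    by rewrite rpredD// rpredZ.
  move=> _ /asboolP[r [v [rs _ ->]]]; move: rs.
  apply: (@submod_span_ind R R^o _
    (fun r => exists m', r *: v - x *: m' \in @prefix_mul R M s i)).
  - by exists 0; rewrite scaler0 subr0 scale0r rpred0.
  - move=> c y z [y' yP] [z' zP]; exists (c *: y' + z').
    rewrite scalerDr scalerDl !scalerA [x * c]mulrC -[c *: y]/(c * y) -!scalerA.
    by rewrite opprD addrACA -scalerBr rpredD// rpredZ.
  move=> y; rewrite /= inE => /predU1P[->|ys].
    by exists v; rewrite subrr rpred0.
  exists 0; rewrite scaler0 subr0; apply: mem_submod_span; apply/asboolP.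
  by exists y, v; split=> //; exact: mem_submod_span.
move=> [m' mP]; rewrite -(subrK (x *: m') m) rpredD//.
  move: mP; apply: submod_span_min => _ /asboolP[r [v [rs _ ->]]].
  apply: mem_submod_span; apply/asboolP; exists r, v; split=> //.
  move: rs; apply: submod_span_min => y ys; apply: mem_submod_span.
  by rewrite /= inE; apply/orP; right.
apply: mem_submod_span; apply/asboolP; exists x, m'; split=> //.
by apply: mem_submod_span; exact: mem_head.
Qed.

Section Quotient.
Variables (M N : lmodType R) (p : {linear M -> N}) (x : R).
Hypothesis p_surj : forall n, exists m, p m = n.
Hypothesis p_ker : forall m, p m = 0 <-> exists m', m = x *: m'.

Lemma prefix_mul_quot s i m :
  p m \in @prefix_mul R N s i <-> m \in @prefix_mul R M (x :: s) i.+1.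
Proof.
(* This covers both k = 0 and an exhausted sequence. *)
have nil_case t k m' : take k t = [::] ->
    p m' \in @prefix_mul R N t k <-> m' \in @prefix_mul R M (x :: t) k.+1.
  move=> tk; rewrite prefix_mul_nil// prefix_mul_cons p_ker.
  split=> -[u]; first by move=> ->; exists u; rewrite subrr rpred0.
  by move=> /(prefix_mul_nil _ tk)/eqP; rewrite subr_eq0 => /eqP; exists u.
elim: i s m => [|i IHi] [|y s] m; try exact: nil_case.
rewrite !prefix_mul_cons; split.
  move=> [n]; have [m1 <-] := p_surj n; rewrite -linearZ -linearB.
  move=> /IHi/prefix_mul_cons[m2 mP]; exists m2.
  by apply/prefix_mul_cons; exists m1; rewrite addrAC.
move=> [m2 /prefix_mul_cons[m1 mP]]; exists (p m1); rewrite -linearZ -linearB.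
by apply/IHi/prefix_mul_cons; exists m2; rewrite addrAC.
Qed.

End Quotient.
End PrefixMul.

Section Sequences.
Variables (R : comPzRingType) (a : submodClosed R^o).
Variables (M N : lmodType R) (p : {linear M -> N}) (x : R).
Hypothesis p_surj : forall n, exists m, p m = n.
Hypothesis p_ker : forall m, p m = 0 <-> exists m', m = x *: m'.

Lemma colon_prefix0 s (J : {pred R^o}) m :
  m \in colon (@prefix_mul R M s 0) J <-> forall r : R, r \in J -> r *: m = 0.
Proof.
split=> [/asboolP Jm r /Jm /prefix_mul_nil|Jm]; first by rewrite take0; apply.
by apply/asboolP => r /Jm /prefix_mul_nil; apply; rewrite take0.
Qed.

Lemma colon_prefix_quot s i (J : {pred R^o}) m :
  p m \in colon (@prefix_mul R N s i) J <->
  m \in colon (@prefix_mul R M (x :: s) i.+1) J.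
Proof.
by split=> /asboolP Jm; apply/asboolP => r /Jm;
  rewrite -linearZ_LR => /(prefix_mul_quot p_surj p_ker).
Qed.

Lemma weak_sequence_cons s : weak_sequence M a (x :: s) <->
  (forall m : M, x *: m = 0 -> forall r : R, r \in a -> r *: m = 0) /\
  weak_sequence N a s.
Proof.
split=> [xsW|[xW sW] [|i] i_s m].
- split=> [m xm|i i_s n].
    by apply/(colon_prefix0 (x :: s))/xsW => //; apply/colon_prefix0 => r /eqP ->.
  have [m <-] := p_surj n => /colon_prefix_quot nJ.
  by apply/colon_prefix_quot/(xsW i.+1).
- by move=> /colon_prefix0 xm; apply/colon_prefix0/xW/xm/eqP.
- by move=> /colon_prefix_quot/sW/colon_prefix_quot; apply.
Qed.

Lemma filter_regular_cons s : filter_regular M a (x :: s) <->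
  (forall m : M, x *: m = 0 -> m \in @torsion_pred R a M) /\
  filter_regular N a s.
Proof.
split=> [xsW|[xW sW] [|i] i_s m].
- split=> [m xm|i i_s n].
    have [|t /colon_prefix0 tm] := xsW 0%N isT m.
      by apply/colon_prefix0 => r /eqP ->.
    by apply/torsionP; exists t.
  have [m <-] := p_surj n => /colon_prefix_quot nJ.
  have [t tm] := xsW i.+1 i_s m nJ.
  by exists t; apply/colon_prefix_quot.
- move=> /colon_prefix0 xm; have /torsionP[t tm] := xW m (xm _ (eqxx _)).
  by exists t; apply/colon_prefix0.
- move=> /colon_prefix_quot/sW [//|t tm].
  by exists t; apply/colon_prefix_quot.
Qed.

End Sequences.

(** * Induction on the length of the sequence *)

Lemma weak_filter_regular (R : comPzRingType) (a : submodClosed R^o) (M : lmodType R)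
    (s : seq R) : weak_sequence M a s -> filter_regular M a s.
Proof.
move=> sW i i_s m /(sW i i_s)/asboolP am; exists 1%N.
by apply/asboolP => r /ideal_exp1_sub/am.
Qed.

(** The module varies in the induction, M/xM taking the place of M. *)
Lemma weak_sequence_cohomology (R : comPzRingType) (a : submodClosed R^o)
    (M : lmodType R) (s : seq R) :
  noetherian R -> {in s, forall x : R, x \in ideal_exp a 2} ->
  weak_sequence M a s <->
  (forall i, (i < size s)%N -> annihilates a (local_cohomology a i M)) /\
  filter_regular M a s.
Proof.
move=> noethR; elim: s M => [|x s IHs] M s_a2.
  by split=> [_|_ i //]; split=> i.
have x_a2 : x \in ideal_exp a 2 by apply: s_a2; rewrite mem_head.
have {}IHs N := IHs N (fun y ys => s_a2 y (mem_behead (s := x :: s) ys)).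
have mulx_lin : linear (fun m : M => x *: m).
  by move=> r u v; rewrite scalerDr !scalerA mulrC.
pose xM := lin_image (mk_linear mulx_lin).
pose p : {linear M -> quot_mod xM} := @quot_proj R M xM.
have p_surj n : exists m, p m = n by exists (repr n); exact: quot_projK.
have p_ker m : p m = 0 <-> exists m', m = x *: m'.
  by rewrite -(linear0 p) /p /= quot_proj_eq subr0; split=> /asboolP.
pose E := injective_resolution_of M.
pose F := injective_resolution_of (quot_mod xM).
split=> [xsW|[aH xsF]].
  split; last exact: weak_filter_regular.
  have [xW /IHs[aHF _]] := (weak_sequence_cons a p_surj p_ker s).1 xsW.
  have [xT _] := (filter_regular_cons a p_surj p_ker s).1 (weak_filter_regular xsW).
  (* Degree 0 comes from the condition on 0 :_M x, degree i+1 from degree i of M/xM. *)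
  case=> [_|i i_s]; first exact: (annihilates_cohomology0 (E := E) x_a2).
  apply: (annihilates_cohomologyS (E := E) x_a2) => r ra.
  apply/(cone_cohomology noethR p_surj p_ker xT E F).
  by move: r ra; apply/annihilates_cohomology/aHF.
have [xT sF] := (filter_regular_cons a p_surj p_ker s).1 xsF.
apply/(weak_sequence_cons a p_surj p_ker); split=> [m /xT|].
  exact: (cohomology0_annihilates (aH 0%N isT)).
apply/IHs; split=> // i i_s; apply/annihilates_cohomology => r ra.
apply/(cone_cohomology noethR p_surj p_ker xT E F).
(* Degree i of M/xM uses degrees i and i+1 of M, both below the length of [x :: s]. *)
by apply: (cone_annihilates (E := E) x_a2) ra; apply: aH => //; exact: ltnW.
Qed.

Unset Implicit Arguments.

Theorem theorem2p6 (R : comPzRingType) (a : submodClosed R^o) (M : lmodType R)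
    (n : nat) (x : n.-tuple R) :
  noetherian R ->
  finitely_generated M ->
  (forall i : 'I_n, tnth x i \in ideal_exp a 2) ->
  weak_sequence M a x <->
  (forall i : nat, (i < n)%N -> annihilates a (local_cohomology a i M)) /\
  filter_regular M a x.
Proof.
move=> noethR _ x_a2; have := @weak_sequence_cohomology R a M x noethR.
by rewrite size_tuple; apply=> y /tnthP[i ->].
Qed.
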